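(* Let $k\ge2$ and let $\psi$ be a characteristic generator. Let $\{B^\ast_i\}_{i=1}^k$ be a partition of the unit interval $(0,1)$ into Borel sets of positive Lebesgue measure such that $$K'(\psi,B^\ast_1)=K'(\psi,B^\ast_2)=\dots=K'(\psi,B^\ast_k).$$ Then, for any $n\in\mathbb{N}$, any elliptical random vector $X\sim E_n(\mu,\Sigma,\psi)$ satisfying the standing assumptions in the context, and $Y=aX$ with $a\in\mathbb{R}^n\setminus\{0\}$ a row vector, $$\mathrm{Cor}_{B_1}[X]=\dots=\mathrm{Cor}_{B_k}[X],$$ where $B_i=\{F_Y(Y)\in B^\ast_i\}$ for $i=1,\dots,k$ and $F_Y$ is the distribution function of $Y$.
   Context: Elliptical vectors: $X\sim E_n(\mu,\Sigma,\psi)$ means that $X=(X_1,\dots,X_n)^T$ is a random vector with $\mathbb{E}[\exp(-ix^T(X-\mu))]=\psi(x^T\Sigma x)$ for all $x\in\mathbb{R}^n$; $\psi$ is called the characteristic generator. Standing assumptions: $X$ has a continuous distribution function and admits the representation $X\stackrel{d}{=}\mu+RAU$, where $R$ is a (strictly) positive random variable with $\mathbb{E}[R^2]=n$, $A$ is an invertible $n\times n$ matrix with $AA^T=\Sigma$ ($\Sigma$ positive definite), and $U$ is independent of $R$ and uniformly distributed on the unit sphere of $\mathbb{R}^n$. Under this normalization $\mathrm{Var}[X]=\Sigma$. $K'$-invariant: for a characteristic generator $\psi$ and a Borel set $A\subseteq(0,1)$ of positive Lebesgue measure, $$K'(\psi,A)=\frac{\mathrm{Var}[V_2\mid F_1(V_1)\in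 A]}{\mathrm{Var}[V_1\mid F_1(V_1)\in A]},$$ where $V=(V_1,V_2)\sim E_2(0,\mathrm{Id}_2,\psi)$ (satisfying the same standing assumptions with $n=2$) and $F_1$ is the distribution function of $V_1$. For an event $B$ with $\mathbb{P}[B]>0$, $\mathrm{Cor}_B[X]$ is the correlation matrix of $X$ under the conditional probability $\mathbb{P}[\,\cdot\mid B]$, i.e. the matrix with entries $\mathrm{Cov}[X_i,X_j\mid B]/\sqrt{\mathrm{Var}[X_i\mid B]\,\mathrm{Var}[X_j\mid B]}$. *)

(* Defs.v *)
From HB Require Import structures.
From mathcomp Require Import all_boot all_order all_algebra.
From mathcomp Require Import complex.
From mathcomp Require Import all_classical all_reals all_analysis.
From mathcomp Require Import measurable_realfun.

Set Implicit Arguments.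
Unset Strict Implicit.
Unset Printing Implicit Defensive.

Import Order.TTheory GRing.Theory Num.Theory.
Import numFieldNormedType.Exports.

Local Open Scope classical_set_scope.
Local Open Scope ring_scope.
Local Open Scope complex_scope.

(* Column vectors carry the product sigma-algebra (the one generated by the
   coordinates), which over a realType is the Borel sigma-algebra of R^n. *)
Definition measure_cV_display : measure_display -> measure_display.
Proof. exact. Qed.

Section measurable_cV.
Context {d : measure_display} {T : measurableType d} (n : nat).

Let coors : 'I_n -> 'cV[T]_n -> T := fun i x => x i ord0.

Let cV_set0 : g_sigma_preimage coors set0.
Proof. exact: sigma_algebra0. Qed.

Let cV_setC A : g_sigma_preimage coors A -> g_sigma_preimage coors (~` A).
Proof. exact: sigma_algebraC. Qed.

Let cV_bigcup (F : (set 'cV[T]_n)^nat) :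
  (forall i, g_sigma_preimage coors (F i)) ->
  g_sigma_preimage coors (\bigcup_i (F i)).
Proof. exact: sigma_algebra_bigcup. Qed.

HB.instance Definition _ := @isMeasurable.Build (measure_cV_display d)
  'cV[T]_n (g_sigma_preimage coors) cV_set0 cV_setC cV_bigcup.

Lemma measurable_coord (i : 'I_n) :
  measurable_fun [set: 'cV[T]_n] (fun x : 'cV[T]_n => x i ord0).
Proof.
move=> _ Y mY; rewrite setTI; apply: sub_sigma_algebra => /=.
rewrite -bigcup_seq/=; exists i => /=; first by rewrite mem_index_enum.
by exists Y => //; rewrite setTI.
Qed.

End measurable_cV.

Section random_vectors.
Context {d : measure_display} {T : measurableType d} {R : realType}
  {P : probability T R} {n : nat}.

Definition rv_coord (X : {RV P >-> 'cV[R]_n}) (i : 'I_n) : T -> R :=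
  fun w => X w i ord0.

Lemma measurable_fun_coord (X : {RV P >-> 'cV[R]_n}) (i : 'I_n) :
  measurable_fun [set: T] (rv_coord X i).
Proof.
by apply: (measurableT_comp (measurable_coord i)); exact: measurable_funPT.
Qed.

HB.instance Definition _ (X : {RV P >-> 'cV[R]_n}) (i : 'I_n) :=
  isMeasurableFun.Build _ _ _ _ (rv_coord X i) (measurable_fun_coord X i).

Definition lincomb (a : 'rV[R]_n) (X : {RV P >-> 'cV[R]_n}) : T -> R :=
  fun w => (a *m X w) ord0 ord0.

Lemma measurable_fun_lincomb (a : 'rV[R]_n) (X : {RV P >-> 'cV[R]_n}) :
  measurable_fun [set: T] (lincomb a X).
Proof.
rewrite (_ : lincomb a X = fun w => \sum_(i < n) a ord0 i * rv_coord X i w);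
  last by apply/funext => w; rewrite /lincomb mxE.
apply: measurable_sum => i.
by apply: measurable_funM => //; exact: measurable_fun_coord.
Qed.

HB.instance Definition _ (a : 'rV[R]_n) (X : {RV P >-> 'cV[R]_n}) :=
  isMeasurableFun.Build _ _ _ _ (lincomb a X) (measurable_fun_lincomb a X).

Definition joint_cdf (X : {RV P >-> 'cV[R]_n}) (x : 'cV[R]_n) : R :=
  fine (P [set w | forall i, rv_coord X i w <= x i ord0]).

End random_vectors.

Section elliptical.
Context {R : realType}.

Definition expCi (t : R) : R[i] := cos t +i* sin t.

Definition Cexpectation d (T : measurableType d) (P : probability T R)
    (Z : T -> R[i]) : R[i] :=
  fine 'E_P[fun w => complex.Re (Z w)]%E +i*
  fine 'E_P[fun w => complex.Im (Z w)]%E.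

Definition has_generator d (T : measurableType d) (P : probability T R) n
    (X : {RV P >-> 'cV[R]_n}) (mu : 'cV[R]_n) (Sigma : 'M[R]_n)
    (psi : R -> R[i]) :=
  forall x : 'cV[R]_n,
    Cexpectation P (fun w => expCi (- (x^T *m (X w - mu)) ord0 ord0))
    = psi ((x^T *m Sigma *m x) ord0 ord0).

Definition independent_RV d (T : measurableType d) (P : probability T R)
    d1 (T1 : measurableType d1) d2 (T2 : measurableType d2)
    (X : {RV P >-> T1}) (Y : {RV P >-> T2}) :=
  forall (A : set T1) (B : set T2), measurable A -> measurable B ->
    P (X @^-1` A `&` Y @^-1` B) = (P (X @^-1` A) * P (Y @^-1` B))%E.

(* The uniform distribution on the unit sphere is the rotation-invariant
   probability measure carried by it. *)
Definition uniform_on_sphere d (T : measurableType d) (P : probability T R) n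
    (U : {RV P >-> 'cV[R]_n}) :=
  (forall w, ((U w)^T *m U w) ord0 ord0 = 1) /\
  (forall O : 'M[R]_n, O^T *m O = 1%:M ->
   forall C : set 'cV[R]_n, measurable C ->
     P [set w | C (O *m U w)] = P [set w | C (U w)]).

Definition posdef n (Sigma : 'M[R]_n) :=
  Sigma^T = Sigma /\
  forall x : 'cV[R]_n, x != 0 -> 0 < (x^T *m Sigma *m x) ord0 ord0.

(* The representation holds in distribution only, hence Rad and U may live on
   another probability space. *)
Definition has_representation d (T : measurableType d) (P : probability T R) n
    (X : {RV P >-> 'cV[R]_n}) (mu : 'cV[R]_n) (Sigma : 'M[R]_n) :=
  exists (d' : measure_display) (T' : measurableType d')
    (P' : probability T' R) (Rad : {RV P' >-> R}) (U : {RV P' >-> 'cV[R]_n})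
    (A : 'M[R]_n),
    [/\ (forall w, 0 < Rad w) /\ ('E_P'[fun w => (Rad w ^+ 2)%R] = n%:R%:E)%E,
        A \in unitmx /\ A *m A^T = Sigma,
        independent_RV Rad U,
        uniform_on_sphere U &
        forall C : set 'cV[R]_n, measurable C ->
          P (X @^-1` C) = P' [set w | C (mu + Rad w *: (A *m U w))]].

Definition elliptical d (T : measurableType d) (P : probability T R) n
    (X : {RV P >-> 'cV[R]_n}) (mu : 'cV[R]_n) (Sigma : 'M[R]_n)
    (psi : R -> R[i]) :=
  [/\ has_generator X mu Sigma psi,
      continuous (joint_cdf X),
      posdef Sigma &
      has_representation X mu Sigma].

(* The probability P[ . | B]; junk value P when B is not an event or when
   P B = 0. *)
Definition cond_prob d (T : measurableType d) (P : probability T R)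
    (B : set T) : probability T R :=
  match pselect (measurable B) with
  | left mB => mnormalize (mrestr P mB) P
  | right _ => P
  end.

(* The event {F_Y(Y) \in A}. *)
Definition cdf_event d (T : measurableType d) (P : probability T R)
    (Y : {RV P >-> R}) (A : set R) : set T :=
  [set w | A (fine (@cdf _ _ _ P Y (Y w)))].

Arguments cdf_event {d T} P Y A.

(* Cor_B[X] *)
Definition cond_cor d (T : measurableType d) (P : probability T R) n
    (B : set T) (X : {RV P >-> 'cV[R]_n}) : 'M[R]_n :=
  let Q := cond_prob P B in
  \matrix_(i, j) (fine (covariance Q (rv_coord X i) (rv_coord X j)) /
    Num.sqrt (fine 'V_Q[rv_coord X i] * fine 'V_Q[rv_coord X j])).

Definition var_ratio d (T : measurableType d) (P : probability T R)
    (V : {RV P >-> 'cV[R]_2}) (A : set R) : R :=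
  let Q := cond_prob P (cdf_event P (rv_coord V 0) A) in
  fine 'V_Q[rv_coord V 1] / fine 'V_Q[rv_coord V 0].

(* psi is the generator of some V ~ E_2(0, Id_2, psi): exactly what
   K'(psi, .) presupposes. *)
Definition char_generator (psi : R -> R[i]) :=
  exists (d : measure_display) (T : measurableType d) (P : probability T R)
    (V : {RV P >-> 'cV[R]_2}), elliptical V 0 1%:M psi.

(* The law of V is determined by psi, so all admissible V give the same
   value. *)
Definition Kprime (psi : R -> R[i]) (A : set R) : R :=
  xget 0 [set kappa | exists (d : measure_display) (T : measurableType d)
    (P : probability T R) (V : {RV P >-> 'cV[R]_2}),
    elliptical V 0 1%:M psi /\ kappa = var_ratio V A].

Definition borel_partition_01 k (B : 'I_k -> set R) :=
  [/\ forall i, measurable (B i) /\ (0 < lebesgue_measure (B i))%E,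
      trivIset setT B &
      \bigcup_(i in [set: 'I_k]) B i = `]0, 1[%classic].

End elliptical.

Arguments cdf_event {R d T} P Y A.
Arguments cond_cor {R d T} P {n} B X.

(* Main.v *)
(* Since the generator determines the law, for every [b] the pair formed by the
   standardization of [a X] and by the centered [b X] is distributed as
   (V_0, p V_0 + r V_1), with p = Cov(a X, b X) / sqrt(Var(a X)) and
   p^2 + r^2 = Var(b X).  The event {F_Y(Y) \in A} becomes {F_1(V_0) \in A};
   given this event V_0 and V_1 are uncorrelated, because V_1 may be replaced by
   -V_1, so the conditional variance of [b X] is Var[V_0 | .] (p^2 + r^2 K') for
   K' the ratio of the conditional variances of V_1 and V_0.  By polarization all
   conditional covariances of X are Var[V_0 | .] times a quantity depending only
   on Sigma, a and K', and the factor cancels in the correlations.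

   Uniqueness of characteristic functions is obtained without inversion formula:
   the functions [g] such that multiplication by [g] preserves the equality of
   the Fourier transforms of [f mu] and [f nu] form an algebra closed under
   bounded pointwise limits; it contains the indicators of the half-spaces
   [c < v i], because [sg (sin (t (v i - c)))] is a limit of polynomials in
   [sin (t (v i - c))], and tends to [sg (v i - c)] as [t] tends to 0. *)

From HB Require Import structures.
Require Import Defs.
From mathcomp Require Import all_boot all_order all_algebra.
From mathcomp Require Import complex.
From mathcomp Require Import all_classical all_reals all_analysis.
From mathcomp Require Import measurable_realfun.
From mathcomp Require Import ring lra.

Set Implicit Arguments.
Unset Strict Implicit.
Unset Printing Implicit Defensive.

Import Order.TTheory GRing.Theory Num.Theory.
Import numFieldNormedType.Exports.

Local Open Scope classical_set_scope.
Local Open Scope ring_scope.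
Local Open Scope measure_display_scope.

(** * Polynomial approximation of the sign function *)

Section sign_approximation.
Context {R : realType}.

(** Odd cubic with fixed points -1, 0 and 1, of which only 0 is repelling: its iterates tend to the
    sign on [-1, 1]. *)
Definition smoothstep (s : R) : R := (3 * s - s ^+ 3) / 2.

Lemma smoothstep_norm (s : R) : `|s| <= 1 -> `|smoothstep s| <= 1.
Proof.
rewrite !ler_norml /smoothstep => /andP[s1 s2]; apply/andP; split.
- have : 0 <= (1 + s) ^+ 2 * (2 - s) by apply: mulr_ge0; [exact: sqr_ge0|lra].
  by rewrite (_ : _ * _ = 2 + 3 * s - s ^+ 3); [lra|ring].
- have : 0 <= (1 - s) ^+ 2 * (2 + s) by apply: mulr_ge0; [exact: sqr_ge0|lra].
  by rewrite (_ : _ * _ = 2 - 3 * s + s ^+ 3); [lra|ring].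
Qed.

Lemma iter_smoothstep_norm (m : nat) (s : R) :
  `|s| <= 1 -> `|iter m smoothstep s| <= 1.
Proof. by move=> s1; elim: m => //= m; exact: smoothstep_norm. Qed.

Lemma iter_smoothstepN (m : nat) (s : R) :
  iter m smoothstep (- s) = - iter m smoothstep s.
Proof. by elim: m => //= m ->; rewrite /smoothstep; ring. Qed.

(** One step multiplies the gap [1 - u] by [1 - (u + u^2) / 2], which is at most [1 - s / 2] because
    the iterates increase from [s]. *)
Lemma iter_smoothstep_pos (m : nat) (s : R) : 0 < s <= 1 ->
  s <= iter m smoothstep s <= 1 /\
  1 - iter m smoothstep s <= (1 - s / 2) ^+ m.
Proof.
move=> /andP[s0 s1]; elim: m => [|m [/andP[]]] /=.
  by rewrite expr0 lexx s1; split => //; lra.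
set u := iter m _ _ => su u1 IH.
have pu : 1 - smoothstep u <= (1 - u) * (1 - s / 2).
  rewrite /smoothstep -subr_ge0.
  rewrite (_ : _ - _ = (1 - u) * (u ^+ 2 + (u - s)) / 2); last by field.
  by rewrite divr_ge0// mulr_ge0 ?subr_ge0// addr_ge0 ?sqr_ge0 ?subr_ge0.
have up : u <= smoothstep u.
  rewrite /smoothstep -subr_ge0.
  rewrite (_ : _ - _ = u * (1 - u) * (1 + u) / 2); last by field.
  have u0 : 0 <= u by rewrite (le_trans (ltW s0)).
  by rewrite divr_ge0// mulr_ge0 ?mulr_ge0 ?subr_ge0// addr_ge0.
split.
  rewrite (le_trans su)//=.
  have /ler_normlP[] // : `|smoothstep u| <= 1.
  apply: smoothstep_norm; rewrite ler_norml u1 andbT; lra.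
rewrite exprSr (le_trans pu)// ler_wpM2r//; lra.
Qed.

Lemma iter_smoothstep_cvg (s : R) : `|s| <= 1 ->
  iter m smoothstep s @[m --> \oo] --> Num.sg s.
Proof.
have pos (t : R) : 0 < t <= 1 -> iter m smoothstep t @[m --> \oo] --> (1 : R).
  move=> t01; have /andP[t0 t1] := t01.
  have cv : (1 - (1 - t / 2) ^+ m) @[m --> \oo] --> (1 : R).
    rewrite -[X in _ --> X]subr0; apply: cvgB; first exact: cvg_cst.
    by apply: cvg_expr; rewrite ger0_norm; lra.
  apply: (squeeze_cvgr _ cv (cvg_cst (1 : R))).
  near=> m; have [/andP[_ ->]] := iter_smoothstep_pos m t01.
  by rewrite andbT; lra.
rewrite ler_norml => /andP[sN1 s1].
case: (ltrgt0P s) => s0.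
- by rewrite gtr0_sg//; apply: pos; rewrite s0.
- rewrite ltr0_sg// -[s]opprK; under eq_fun do rewrite iter_smoothstepN.
  by apply: cvgN; apply: pos; lra.
- rewrite s0 sgr0 (_ : (fun _ => _) = cst 0); first exact: cvg_cst.
  by apply/funext; elim => //= m ->; rewrite /smoothstep; ring.
Unshelve. all: by end_near. Qed.

End sign_approximation.

(** * Uniqueness of characteristic functions *)

Section charfun_uniqueness.
Context {R : realType} {n : nat} (mu nu : probability 'cV[R]_n R).
Implicit Types (f g : 'cV[R]_n -> R) (x v : 'cV[R]_n).

Definition dotc x v : R := (x^T *m v) ord0 ord0.

Lemma dotcDl x y v : dotc (x + y) v = dotc x v + dotc y v.
Proof. by rewrite /dotc linearD mulmxDl mxE. Qed.

Lemma dotcBl x y v : dotc (x - y) v = dotc x v - dotc y v.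
Proof. by rewrite /dotc linearB mulmxBl !mxE. Qed.

Lemma measurable_dotc x : measurable_fun [set: 'cV[R]_n] (dotc x).
Proof.
rewrite (_ : dotc x = fun v => \sum_(i < n) x i ord0 * v i ord0); last first.
  by apply/funext => v; rewrite /dotc mxE; apply: eq_bigr => i _; rewrite mxE.
apply: measurable_sum => i; apply: measurable_funM => //.
exact: measurable_coord.
Qed.

Definition bounded_mfun f :=
  measurable_fun [set: 'cV[R]_n] f /\ exists C, forall v, `|f v| <= C.

Definition same_integral f :=
  (\int[mu]_v (f v)%:E = \int[nu]_v (f v)%:E)%E.

(** Equality of the Fourier transforms of [f mu] and [f nu], split into real and imaginary parts to
    stay with real integrals. *)
Definition same_charfun f := forall x,
  same_integral (fun v => f v * cos (dotc x v)) /\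
  same_integral (fun v => f v * sin (dotc x v)).

(** Quantifying over every [f] makes the class closed under products: two multipliers are applied in
    turn. *)
Definition charfun_multiplier g := bounded_mfun g /\
  forall f, bounded_mfun f -> same_charfun f -> same_charfun (fun v => f v * g v).

Lemma bounded_mfun_integrable (m : probability 'cV[R]_n R) f :
  bounded_mfun f -> m.-integrable setT (EFin \o f).
Proof.
move=> [mf [C fC]]; apply: (@le_integrable _ _ _ _ _ _ _ (cst C%:E)) => //.
- exact/measurable_EFinP.
- by move=> v _ /=; rewrite lee_fin (le_trans (fC v))// ler_norm.
- exact: finite_measure_integrable_cst.
Qed.

Lemma bounded_mfunD f g : bounded_mfun f -> bounded_mfun g ->
  bounded_mfun (fun v => f v + g v).
Proof.
move=> [mf [C fC]] [mg [D gD]]; split; first exact: measurable_funD.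
by exists (C + D) => v; rewrite (le_trans (ler_normD _ _))// lerD.
Qed.

Lemma bounded_mfunM f g : bounded_mfun f -> bounded_mfun g ->
  bounded_mfun (fun v => f v * g v).
Proof.
move=> [mf [C fC]] [mg [D gD]]; split; first exact: measurable_funM.
by exists (C * D) => v; rewrite normrM ler_pM.
Qed.

Lemma bounded_mfun_cst (c : R) : bounded_mfun (fun=> c).
Proof. by split; [exact: measurable_cst|exists `|c|]. Qed.

Lemma bounded_mfun_cos x : bounded_mfun (fun v => cos (dotc x v)).
Proof.
split; last by exists 1 => v; exact: cos_max.
apply: measurableT_comp; last exact: measurable_dotc.
by apply: continuous_measurable_fun; exact: continuous_cos.
Qed.

Lemma bounded_mfun_sin x : bounded_mfun (fun v => sin (dotc x v)).
Proof.
split; last by exists 1 => v; exact: sin_max.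
apply: measurableT_comp; last exact: measurable_dotc.
by apply: continuous_measurable_fun; exact: continuous_sin.
Qed.

Lemma same_integralD f g : bounded_mfun f -> bounded_mfun g ->
  same_integral f -> same_integral g -> same_integral (fun v => f v + g v).
Proof.
move=> bf bg; rewrite /same_integral => If Ig.
have E (m : probability 'cV[R]_n R) : (\int[m]_v (f v + g v)%:E =
    \int[m]_v (f v)%:E + \int[m]_v (g v)%:E)%E.
  by rewrite -integralD_EFin//; exact: bounded_mfun_integrable.
by rewrite !E If Ig.
Qed.

Lemma same_integralZ (c : R) f : bounded_mfun f ->
  same_integral f -> same_integral (fun v => f v * c).
Proof.
move=> bf; rewrite /same_integral => If.
have E (m : probability 'cV[R]_n R) : (\int[m]_v (f v * c)%:E =
    \int[m]_v (f v)%:E * c%:E)%E.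
  by rewrite -integralZr//; exact: bounded_mfun_integrable.
by rewrite !E If.
Qed.

Lemma bounded_mfun_lim (C : R) (f_ : nat -> 'cV[R]_n -> R) f :
  (forall m, measurable_fun [set: 'cV[R]_n] (f_ m)) ->
  (forall m v, `|f_ m v| <= C) ->
  (forall v, f_ m v @[m --> \oo] --> f v) -> bounded_mfun f.
Proof.
move=> mf fC fcvg; split.
  by apply: (@measurable_fun_cvg _ _ _ _ f_) => // v _; exact: fcvg.
exists C => v; apply: (cvgr_to_le (cvg_norm (fcvg v))).
by apply: nearW => m; exact: fC.
Qed.

(** Dominated convergence under [mu] and under [nu], with a constant as dominating function. *)
Lemma same_integral_lim (C : R) (f_ : nat -> 'cV[R]_n -> R) f :
  (forall m, measurable_fun [set: 'cV[R]_n] (f_ m)) ->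
  (forall m v, `|f_ m v| <= C) ->
  (forall v, f_ m v @[m --> \oo] --> f v) ->
  (forall m, same_integral (f_ m)) -> same_integral f.
Proof.
move=> mf fC fcvg If.
have cvgI (m : probability 'cV[R]_n R) :
    (\int[m]_v (f_ k v)%:E @[k --> \oo] --> \int[m]_v (f v)%:E)%E.
  have [mf0 _] := bounded_mfun_lim mf fC fcvg.
  have [] := @dominated_convergence _ _ _ m setT measurableT
    (fun k => EFin \o f_ k) (EFin \o f) (cst C%:E) => //.
  - by move=> k; exact/measurable_EFinP.
  - exact/measurable_EFinP.
  - by apply: aeW => v _; apply: cvg_EFin; [exact: nearW|exact: fcvg].
  - exact: finite_measure_integrable_cst.
  - by apply: aeW => v k _; rewrite lee_fin.
have := cvgI mu; rewrite (_ : (fun k => _) = fun k => \int[nu]_v (f_ k v)%:E)%E.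
  by move=> /cvg_unique; apply => //; exact: cvgI.
by apply/funext => k; exact: If.
Qed.

(** By the product-to-sum formulas, the factor [cos (dotc x v)] averages the transform over the
    frequencies [y + x] and [y - x]. *)
Lemma same_charfun_cos f x : bounded_mfun f -> same_charfun f ->
  same_charfun (fun v => f v * cos (dotc x v)).
Proof.
move=> bf If y.
have bC z := bounded_mfunM bf (bounded_mfun_cos z).
have bS z := bounded_mfunM bf (bounded_mfun_sin z).
split.
- rewrite (_ : (fun v => _) = fun v => (f v * cos (dotc (y + x) v) +
      f v * cos (dotc (y - x) v)) * 2^-1); last first.
    by apply/funext => v; rewrite dotcDl dotcBl cosB cosD; field.
  by apply: same_integralZ; [exact: bounded_mfunD|apply: same_integralD => //];
    exact: (If _).1.
- rewrite (_ : (fun v => _) = fun v => (f v * sin (dotc (y + x) v) +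
      f v * sin (dotc (y - x) v)) * 2^-1); last first.
    by apply/funext => v; rewrite dotcDl dotcBl sinB sinD; field.
  by apply: same_integralZ; [exact: bounded_mfunD|apply: same_integralD => //];
    exact: (If _).2.
Qed.

Lemma same_charfun_sin f x : bounded_mfun f -> same_charfun f ->
  same_charfun (fun v => f v * sin (dotc x v)).
Proof.
move=> bf If y.
have bC z := bounded_mfunM bf (bounded_mfun_cos z).
have bS z := bounded_mfunM bf (bounded_mfun_sin z).
split.
- rewrite (_ : (fun v => _) = fun v => (f v * sin (dotc (y + x) v) +
      f v * sin (dotc (x - y) v)) * 2^-1); last first.
    by apply/funext => v; rewrite dotcDl dotcBl sinB sinD; field.
  by apply: same_integralZ; [exact: bounded_mfunD|apply: same_integralD => //];
    exact: (If _).2.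
- rewrite (_ : (fun v => _) = fun v => (f v * cos (dotc (y - x) v) +
      f v * cos (dotc (y + x) v) * -1) * 2^-1); last first.
    by apply/funext => v; rewrite dotcBl dotcDl cosB cosD; field.
  have b1 : bounded_mfun (fun v => f v * cos (dotc (y + x) v) * -1).
    by apply: bounded_mfunM => //; exact: bounded_mfun_cst.
  apply: same_integralZ; first exact: bounded_mfunD.
  apply: same_integralD => //; first exact: (If _).1.
  by apply: same_integralZ => //; exact: (If _).1.
Qed.

Lemma same_charfunD f g : bounded_mfun f -> bounded_mfun g ->
  same_charfun f -> same_charfun g -> same_charfun (fun v => f v + g v).
Proof.
move=> bf bg If Ig x; split.
- under eq_fun do rewrite mulrDl.
  by apply: same_integralD; [exact: bounded_mfunM (bounded_mfun_cos x)..|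
    exact: (If x).1|exact: (Ig x).1].
- under eq_fun do rewrite mulrDl.
  by apply: same_integralD; [exact: bounded_mfunM (bounded_mfun_sin x)..|
    exact: (If x).2|exact: (Ig x).2].
Qed.

Lemma same_charfunZ (c : R) f : bounded_mfun f ->
  same_charfun f -> same_charfun (fun v => f v * c).
Proof.
move=> bf If x; split.
- under eq_fun do rewrite mulrAC.
  by apply: same_integralZ; [exact: bounded_mfunM (bounded_mfun_cos x)|
    exact: (If x).1].
- under eq_fun do rewrite mulrAC.
  by apply: same_integralZ; [exact: bounded_mfunM (bounded_mfun_sin x)|
    exact: (If x).2].
Qed.

Lemma charfun_multiplier_cos x : charfun_multiplier (fun v => cos (dotc x v)).
Proof. by split; [exact: bounded_mfun_cos|move=> f; exact: same_charfun_cos]. Qed.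

Lemma charfun_multiplier_sin x : charfun_multiplier (fun v => sin (dotc x v)).
Proof. by split; [exact: bounded_mfun_sin|move=> f; exact: same_charfun_sin]. Qed.

Lemma charfun_multiplier_cst (c : R) : charfun_multiplier (fun=> c).
Proof. by split; [exact: bounded_mfun_cst|move=> f; exact: same_charfunZ]. Qed.

Lemma charfun_multiplierD f g : charfun_multiplier f -> charfun_multiplier g ->
  charfun_multiplier (fun v => f v + g v).
Proof.
move=> [bf Mf] [bg Mg]; split; first exact: bounded_mfunD.
move=> h bh Ih; under eq_fun do rewrite mulrDr.
by apply: same_charfunD; [exact: bounded_mfunM..|exact: Mf|exact: Mg].
Qed.

Lemma charfun_multiplierM f g : charfun_multiplier f -> charfun_multiplier g ->
  charfun_multiplier (fun v => f v * g v).
Proof.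
move=> [bf Mf] [bg Mg]; split; first exact: bounded_mfunM.
move=> h bh Ih; under eq_fun do rewrite mulrA.
by apply: Mg; [exact: bounded_mfunM|exact: Mf].
Qed.

Lemma charfun_multiplier_lim (C : R) (g_ : nat -> 'cV[R]_n -> R) g :
  (forall m v, `|g_ m v| <= C) ->
  (forall v, g_ m v @[m --> \oo] --> g v) ->
  (forall m, charfun_multiplier (g_ m)) -> charfun_multiplier g.
Proof.
move=> gC gcvg Mg; split.
  by apply: bounded_mfun_lim gC gcvg => m; exact: (Mg m).1.1.
move=> f [mf [D fD]] If x.
have H (c : 'cV[R]_n -> R) : bounded_mfun c -> (forall v, `|c v| <= 1) ->
    (forall m, same_integral (fun v => f v * g_ m v * c v)) ->
    same_integral (fun v => f v * g v * c v).
  move=> [mc _] c1; apply: (@same_integral_lim (D * C)).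
  - move=> m; apply: measurable_funM => //; apply: measurable_funM => //.
    exact: (Mg m).1.1.
  - move=> m v; rewrite 2!normrM -[leRHS]mulr1.
    by rewrite !ler_pM// mulr_ge0.
  - by move=> v; apply: cvgMr_tmp; apply: cvgMl_tmp; exact: gcvg.
have bf : bounded_mfun f by split => //; exists D.
split; apply: H.
- exact: bounded_mfun_cos.
- by move=> v; exact: cos_max.
- by move=> m; exact: ((Mg m).2 f bf If x).1.
- exact: bounded_mfun_sin.
- by move=> v; exact: sin_max.
- by move=> m; exact: ((Mg m).2 f bf If x).2.
Qed.

(** Each iterate of [smoothstep] is a polynomial in [g], hence a multiplier, and the iterates
    converge boundedly to the sign. *)
Lemma charfun_multiplier_sg g : (forall v, `|g v| <= 1) ->
  charfun_multiplier g -> charfun_multiplier (fun v => Num.sg (g v)).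
Proof.
move=> g1 Mg.
apply: (@charfun_multiplier_lim 1 (fun m v => iter m smoothstep (g v))).
- by move=> m v; exact: iter_smoothstep_norm.
- by move=> v; exact: iter_smoothstep_cvg.
elim => [//|m IH] /=; set u := (fun v => iter m _ _) in IH.
rewrite (_ : (fun v => _) = fun v => 3 / 2 * u v + - 2^-1 * (u v * (u v * u v))).
  apply: charfun_multiplierD.
    by apply: charfun_multiplierM => //; exact: charfun_multiplier_cst.
  apply: charfun_multiplierM; first exact: charfun_multiplier_cst.
  by do 2 apply: charfun_multiplierM => //.
by apply/funext => v; rewrite /smoothstep -/(u v); field.
Qed.

Lemma sin_small_sg (t : R) :
  Num.sg (sin (m.+1%:R^-1 * t)) @[m --> \oo] --> Num.sg t.
Proof.
apply: cvg_near_cst.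
have tm : \forall m \near \oo, `|t| < m.+1%:R :> R.
  near=> m; rewrite (@lt_trans _ _ m%:R)// ?ltr_nat//.
  by near: m; exact: nbhs_infty_gtr.
(* Sine being odd, the sign of [t] is pulled out; the argument left is in absolute value below 1,
   where sine has the sign of its argument. *)
near=> m; rewrite {1}[t]numEsg mulrCA sin_sg sgrM sgr_id.
have [->|t0] := eqVneq t 0; first by rewrite sgr0 mul0r.
rewrite [X in _ * X]gtr0_sg ?mulr1//; apply: sin2_gt0; apply/andP; split.
  by rewrite mulr_gt0// ?invr_gt0 ?normr_gt0.
rewrite (@lt_trans _ _ 1)// ?ltr1n// mulrC ltr_pdivrMr// mul1r.
by near: m.
Unshelve. all: by end_near. Qed.

Lemma charfun_multiplier_halfspace (i : 'I_n) (c : R) :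
  charfun_multiplier (\1_[set v : 'cV[R]_n | c < v i ord0]).
Proof.
pose s v := Num.sg (v i ord0 - c).
have Ms : charfun_multiplier s.
  (* Frequencies on the axis [i] shrinking to 0, as [sin_small_sg] requires. *)
  pose x (m : nat) : 'cV[R]_n := m.+1%:R^-1 *: delta_mx i ord0.
  have xE m v : dotc (x m) v = m.+1%:R^-1 * v i ord0.
    rewrite /dotc /x mxE (bigD1 i)//= !mxE !eqxx mulr1 big1 ?addr0// => j ji.
    by rewrite !mxE (negbTE ji) mulr0 mul0r.
  apply: (@charfun_multiplier_lim 1
      (fun m v => Num.sg (sin (m.+1%:R^-1 * (v i ord0 - c))))).
  - by move=> m v; rewrite normr_sg lern1 leq_b1.
  - by move=> v; exact: sin_small_sg.
  move=> m; apply: charfun_multiplier_sg => [v|]; first exact: sin_max.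
  pose d := m.+1%:R^-1 * c.
  rewrite (_ : (fun v => _) = fun v => sin (dotc (x m) v) * cos d +
    cos (dotc (x m) v) * (- sin d)); last first.
    by apply/funext => v; rewrite mulrBr -xE sinB mulrN.
  by apply: charfun_multiplierD; apply: charfun_multiplierM;
    [exact: charfun_multiplier_sin|exact: charfun_multiplier_cst|
     exact: charfun_multiplier_cos|exact: charfun_multiplier_cst].
(* [(s + s^2) / 2] sends 1 to 1 and both -1 and 0 to 0; the value at 0 excludes the boundary
   hyperplane. *)
rewrite (_ : \1__ = fun v => 2^-1 * (s v + s v * s v)).
  apply: charfun_multiplierM; first exact: charfun_multiplier_cst.
  by apply: charfun_multiplierD => //; exact: charfun_multiplierM.
apply/funext => v; rewrite indicE /s; have [cv|vc|cE] := ltrgtP c (v i ord0).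
- by rewrite mem_set// gtr0_sg ?subr_gt0//= mulr1n; field.
- rewrite memNset /=; last by apply/negP; rewrite -leNgt ltW.
  by rewrite ltr0_sg ?subr_lt0//; field.
- rewrite memNset /=; last by rewrite -cE ltxx.
  by rewrite -cE subrr sgr0 mulr0 addr0 mulr0.
Qed.

(** Closure under products gives unions of two sets, disjoint or not; countable unions are bounded
    pointwise limits of finite ones. *)
Lemma charfun_multiplier_sigma_algebra :
  sigma_algebra setT [set A : set 'cV[R]_n | charfun_multiplier (\1_A)].
Proof.
split => /=.
- by rewrite indic0; exact: charfun_multiplier_cst.
- move=> A MA; rewrite setTD (_ : \1_(~` A) = fun v => 1 + -1 * \1_A v).
    apply: charfun_multiplierD; first exact: charfun_multiplier_cst.
    by apply: charfun_multiplierM => //; exact: charfun_multiplier_cst.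
  by apply/funext => v; rewrite !indicE in_setC; case: (v \in A) => /=; ring.
move=> A MA; pose B m := \big[setU/set0]_(i < m) A i.
have MB m : charfun_multiplier (\1_(B m)).
  rewrite /B; elim: m => [|m IH].
    by rewrite big_ord0 indic0; exact: charfun_multiplier_cst.
  rewrite big_ord_recr/=; set U := \big[_/_]_(_ < _) _ in IH *.
  rewrite (_ : \1_(_ `|` _) = fun v => \1_U v + \1_(A m) v * (1 + -1 * \1_U v)).
    apply: charfun_multiplierD => //; apply: charfun_multiplierM => //.
    apply: charfun_multiplierD; first exact: charfun_multiplier_cst.
    by apply: charfun_multiplierM => //; exact: charfun_multiplier_cst.
  apply/funext => v; rewrite !indicE in_setU.
  by case: (v \in U); case: (v \in A m) => /=; ring.
apply: (@charfun_multiplier_lim 1 (fun m => \1_(B m))) => // [m v|v].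
  by rewrite indicE normr_nat lern1 leq_b1.
apply: cvg_near_cst.
have [[k _ Akv]|vA] := pselect ((\bigcup_k A k) v); last first.
  near=> m; rewrite !indicE !memNset//.
  move=> Bv; apply: vA; move: Bv; rewrite /B -bigcup_mkord => -[j _ Aj].
  by exists j.
near=> m; rewrite !indicE !mem_set//; first by exists k.
rewrite /B -bigcup_mkord; exists k => //=.
by near: m; exact: nbhs_infty_gt.
Unshelve. all: by end_near. Qed.

Lemma charfun_unique :
  (forall x, same_integral (fun v => cos (dotc x v)) /\
             same_integral (fun v => sin (dotc x v))) ->
  forall A : set 'cV[R]_n, measurable A -> mu A = nu A.
Proof.
move=> H A mA.
have M1 : charfun_multiplier (\1_A).
  (* Two generation steps: preimages under coordinates generate the product sigma-algebra, and open
     rays generate the Borel sets of the line. *)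
  move: A mA; apply: smallest_sub; first exact: charfun_multiplier_sigma_algebra.
  rewrite -bigcup_seq => _ [i _] [B mB <-] /=; rewrite setTI.
  have : ((@RGenOInfty.G R).-sigma.-measurable B).
    by rewrite -RGenOInfty.measurableE.
  move: B {mB}; apply: smallest_sub.
    have [S0 SC SU] := charfun_multiplier_sigma_algebra; split => /=.
    + by rewrite preimage_set0.
    + by move=> B; rewrite !setTD preimage_setC => /SC; rewrite setTD.
    + by move=> F MF; rewrite preimage_bigcup; exact: SU.
  move=> _ [c ->].
  have -> : (fun v : 'cV[R]_n => v i ord0) @^-1` `]c, +oo[ =
      [set v | c < v i ord0].
    by apply/seteqP; split => v; rewrite /= in_itv/= andbT.
  exact: charfun_multiplier_halfspace.
have H1 : same_charfun (fun=> 1).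
  move=> x; have [hc hs] := H x; split.
  - by rewrite (_ : (fun v => _) = fun v => cos (dotc x v))//;
      apply/funext => v; rewrite mul1r.
  - by rewrite (_ : (fun v => _) = fun v => sin (dotc x v))//;
      apply/funext => v; rewrite mul1r.
(* At frequency 0 the cosine is 1, which leaves the integral of [\1_A]. *)
have [+ _] := M1.2 _ (bounded_mfun_cst 1) H1 0.
rewrite (_ : (fun v => _) = \1_A); last first.
  by apply/funext => v; rewrite mul1r /dotc trmx0 mul0mx mxE cos0 mulr1.
by rewrite /same_integral !integral_indic ?setIT.
Qed.

End charfun_uniqueness.

(** * Equality in law, conditioning and square integrability *)

Section eq_law.
Context {R : realType}.

Lemma measurable_fun_cV d (T : measurableType d) n (f : T -> 'cV[R]_n) :
  (forall i, measurable_fun [set: T] (fun w => f w i ord0)) ->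
  measurable_fun [set: T] f.
Proof.
move=> mf _ C mC; rewrite setTI; move: C mC; apply: smallest_sub.
  split => /=.
  - by rewrite preimage_set0.
  - by move=> A mA; rewrite setTD preimage_setC; exact: measurableC.
  - by move=> F mF; rewrite preimage_bigcup; exact: bigcup_measurable.
rewrite -bigcup_seq => _ [i _] [B mB <-] /=; rewrite setTI -(setTI (_ @^-1` _)).
exact: mf.
Qed.

(** [Z] and [Z'] are bare functions, so that they can be kept while [P] and [P'] are replaced by
    conditional probabilities. *)
Definition eq_law d (T : measurableType d) (P : probability T R)
    d' (T' : measurableType d') (P' : probability T' R) n
    (Z : T -> 'cV[R]_n) (Z' : T' -> 'cV[R]_n) :=
  forall C, measurable C -> P (Z @^-1` C) = P' (Z' @^-1` C).

Section eq_law_expectation.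
Context d (T : measurableType d) (P : probability T R)
  d' (T' : measurableType d') (P' : probability T' R) n
  (Z : T -> 'cV[R]_n) (Z' : T' -> 'cV[R]_n).
Hypotheses (mZ : measurable_fun [set: T] Z) (mZ' : measurable_fun [set: T'] Z').

Lemma expectation_eq_law (f : 'cV[R]_n -> R) :
  eq_law P P' Z Z' -> measurable_fun [set: 'cV[R]_n] f ->
  ('E_P[f \o Z] = 'E_P'[f \o Z'])%E.
Proof.
move=> ZZ' mf; rewrite unlock.
(* Change of variables for nonnegative functions; applied to positive and negative parts, it also
   covers non-integrable [f]. *)
have ge0_case (g : 'cV[R]_n -> \bar R) : measurable_fun [set: 'cV[R]_n] g ->
    (forall v, 0 <= g v)%E -> (\int[P]_w g (Z w) = \int[P']_w g (Z' w))%E.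
  move=> mg g0.
  pose Zm : {RV P >-> 'cV[R]_n} :=
    HB.pack Z (isMeasurableFun.Build _ _ _ _ Z mZ).
  pose Zm' : {RV P' >-> 'cV[R]_n} :=
    HB.pack Z' (isMeasurableFun.Build _ _ _ _ Z' mZ').
  rewrite -(ge0_integral_distribution Zm)//.
  rewrite -(ge0_integral_distribution Zm')//.
  by apply: eq_measure_integral => A mA _; exact: ZZ'.
have mEf : measurable_fun [set: 'cV[R]_n] (EFin \o f) by exact/measurable_EFinP.
rewrite integralE [RHS]integralE; congr (_ - _)%E.
- have := ge0_case _ (measurable_funepos mEf) (funepos_ge0 _).
  by rewrite funepos.unlock.
- have := ge0_case _ (measurable_funeneg mEf) (funeneg_ge0 _).
  by rewrite funeneg.unlock.
Qed.

Lemma variance_eq_law (f : 'cV[R]_n -> R) :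
  eq_law P P' Z Z' -> measurable_fun [set: 'cV[R]_n] f ->
  ('V_P[f \o Z] = 'V_P'[f \o Z'])%E.
Proof.
move=> ZZ' mf; rewrite /variance unlock (expectation_eq_law ZZ' mf).
set m := fine _.
apply: (@expectation_eq_law (fun v => (f v - m) * (f v - m))) => //.
by apply: measurable_funM; exact: measurable_funB.
Qed.

End eq_law_expectation.

Section cond_prob.
Context d (T : measurableType d) (P : probability T R).

Lemma cond_probE (B C : set T) : measurable B -> measurable C ->
  cond_prob P B C =
  if P B == 0%E then P C else (P (C `&` B) * (fine (P B))^-1%:E)%E.
Proof.
move=> mB mC; rewrite /cond_prob; case: pselect => // mB'.
have E : (mrestr P mB' : {measure set T -> \bar R}) setT = P B.
  by rewrite /= /mrestr setTI.
rewrite /= /mnormalize E.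
(* [mnormalize] falls back on [P] for a total mass of 0 or [+oo]; the latter is ruled out here. *)
have /negbTE Boo : P B != +oo%E.
  by rewrite -ltey (le_lt_trans (probability_le1 P mB))// ltry.
by rewrite Boo orbF; case: ifP.
Qed.

End cond_prob.

Section Lfun2.
Context d (T : measurableType d) (P : probability T R).

Lemma Lfun2P (f : T -> R) : measurable_fun [set: T] f ->
  ('E_P[fun w => (f w ^+ 2)%R] < +oo)%E -> f \in Lfun P 2%:E.
Proof.
move=> mf; rewrite unlock => f2; rewrite inE; apply/andP; split; rewrite inE//=.
rewrite /finite_norm unlock /Lnorm poweR_lty//.
by under eq_integral do rewrite /= powR_mulrn// real_normK ?num_real//.
Qed.

Lemma Lfun2_expectation (f : T -> R) : f \in Lfun P 2%:E ->
  ('E_P[fun w => (f w ^+ 2)%R] < +oo)%E.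
Proof.
move=> /Lfun2_integrable_sqr /integrableP[_]; rewrite expectation.unlock.
by under eq_integral do rewrite gee0_abs ?lee_fin ?sqr_ge0//.
Qed.

Lemma Lfun2_measurable (f : T -> R) : f \in Lfun P 2%:E ->
  measurable_fun [set: T] f.
Proof. by rewrite inE => /andP[+ _]; rewrite inE. Qed.

End Lfun2.

(** The conditional probability is bounded by [P] divided by [P B], or is [P] itself when [P B]
    vanishes. *)
Lemma Lfun2_cond d (T : measurableType d) (P : probability T R) (B : set T)
    (f : T -> R) : measurable B ->
  f \in Lfun P 2%:E -> f \in Lfun (cond_prob P B) 2%:E.
Proof.
move=> mB fP; apply: Lfun2P; first exact: Lfun2_measurable fP.
have := Lfun2_expectation fP; rewrite unlock => fP2.
have mf2 : measurable_fun [set: T] (fun w => (f w ^+ 2)%:E).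
  by apply/measurable_EFinP; apply: measurable_funX; exact: Lfun2_measurable fP.
have [PB0|PB0] := eqVneq (P B) 0%E.
  rewrite (@eq_measure_integral _ _ _ _ P)// => A mA _.
  by rewrite [LHS](cond_probE P mB mA) PB0 eqxx.
have k0 : 0 <= (fine (P B))^-1 by rewrite invr_ge0 fine_ge0.
rewrite (@eq_measure_integral _ _ _ _ (mscale (NngNum k0) (mrestr P mB))).
  rewrite ge0_integral_mscale//; last by move=> w _; rewrite lee_fin sqr_ge0.
  apply: lte_mul_pinfty => //.
  apply: le_lt_trans fP2; apply: ge0_le_measure_integral => //.
  - move=> A mA; suff : (P (A `&` B) <= P A)%E by [].
    by rewrite le_measure// ?inE//; exact: measurableI.
  - by move=> w; rewrite lee_fin sqr_ge0.
move=> A mA _; rewrite [LHS](cond_probE P mB mA) (negbTE PB0).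
by rewrite /mscale/= /mrestr muleC.
Qed.

(** The conditioning events are preimages of one set [E], so all probabilities involved are
    determined by the common law. *)
Lemma eq_law_cond d (T : measurableType d) (P : probability T R)
    d' (T' : measurableType d') (P' : probability T' R) n
    (Z : T -> 'cV[R]_n) (Z' : T' -> 'cV[R]_n) (E : set 'cV[R]_n) :
  measurable_fun [set: T] Z -> measurable_fun [set: T'] Z' -> measurable E ->
  eq_law P P' Z Z' ->
  eq_law (cond_prob P (Z @^-1` E)) (cond_prob P' (Z' @^-1` E)) Z Z'.
Proof.
move=> mZ mZ' mE ZZ' C mC.
have mp (D : set 'cV[R]_n) : measurable D -> measurable (Z @^-1` D).
  by move=> mD; rewrite -[_ @^-1` _]setTI; exact: mZ.
have mp' (D : set 'cV[R]_n) : measurable D -> measurable (Z' @^-1` D).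
  by move=> mD; rewrite -[_ @^-1` _]setTI; exact: mZ'.
rewrite (cond_probE P (mp _ mE) (mp _ mC)) (cond_probE P' (mp' _ mE) (mp' _ mC)).
rewrite -(preimage_setI Z) -(preimage_setI Z').
by rewrite (ZZ' _ mE) (ZZ' _ mC) (ZZ' _ (measurableI _ _ mC mE)).
Qed.

End eq_law.

(** * The generator determines the laws of affine images *)

Section generator.
Context {R : realType}.

Lemma measurable_affine d (T : measurableType d) n m (f : T -> 'cV[R]_n)
    (M : 'M[R]_(m, n)) (mu : 'cV[R]_n) : measurable_fun [set: T] f ->
  measurable_fun [set: T] (fun w => M *m (f w - mu)).
Proof.
move=> mf; apply: measurable_fun_cV => i.
rewrite (_ : (fun w => _) =
  fun w => \sum_(j < n) M i j * (f w j ord0 - mu j ord0)); last first.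
  by apply/funext => w; rewrite mxE; apply: eq_bigr => j _; rewrite !mxE.
apply: measurable_sum => j; apply: measurable_funM => //.
apply: measurable_funB => //; exact: (measurableT_comp (measurable_coord j)).
Qed.

(** The generator is used at [- (M^T *m x)], whose sign cancels the one in the exponent of
    [has_generator]. *)
Lemma charfun_affine d (T : measurableType d) (P : probability T R) n
    (X : {RV P >-> 'cV[R]_n}) mu Sigma psi m (M : 'M[R]_(m, n)) (x : 'cV[R]_m) :
  has_generator X mu Sigma psi ->
  ((\int[P]_w (cos (dotc x (M *m (X w - mu))))%:E)%E =
    (complex.Re (psi (dotc x (M *m Sigma *m M^T *m x))))%:E) /\
  ((\int[P]_w (sin (dotc x (M *m (X w - mu))))%:E)%E =
    (complex.Im (psi (dotc x (M *m Sigma *m M^T *m x))))%:E).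
Proof.
move=> /(_ (- (M^T *m x))).
have mZ := measurable_affine M mu (measurable_funPT X).
have mD : measurable_fun [set: T] (fun w => dotc x (M *m (X w - mu))).
  by apply: (measurableT_comp (measurable_dotc x)).
have trN : (- (M^T *m x))^T = - (x^T *m M) by rewrite linearN/= trmx_mul trmxK.
rewrite (_ : (_ *m Sigma *m _) ord0 ord0 =
    dotc x (M *m Sigma *m M^T *m x)); last first.
  by rewrite /dotc trN mulmxN !mulNmx opprK !mulmxA.
have arg w : - ((- (M^T *m x))^T *m (X w - mu)) ord0 ord0 =
    dotc x (M *m (X w - mu)).
  by rewrite /dotc trN mulNmx [X in - X]mxE opprK mulmxA.
rewrite (_ : (fun w => expCi _) = fun w => expCi (dotc x (M *m (X w - mu))));
  last by apply/funext => w; rewrite arg.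
move=> E.
(* [Cexpectation] takes [fine] of its two parts; boundedness makes them finite, so that [fine] loses
   nothing. *)
have fin (g : R -> R) : measurable_fun setT g -> (forall t, `|g t| <= 1) ->
   (\int[P]_w (g (dotc x (M *m (X w - mu))))%:E)%E \is a fin_num.
  move=> mg g1; apply: integrable_fin_num => //.
  apply: (@le_integrable _ _ _ _ _ _ _ (cst 1%:E)) => //.
  - by apply/measurable_EFinP; exact: measurableT_comp.
  - by move=> w _ /=; rewrite lee_fin normr1.
  - exact: finite_measure_integrable_cst.
split.
- rewrite -E /= expectation.unlock fineK//.
  apply: fin => [|t]; last exact: cos_max.
  by apply: continuous_measurable_fun; exact: continuous_cos.
- rewrite -E /= expectation.unlock fineK//.
  apply: fin => [|t]; last exact: sin_max.
  by apply: continuous_measurable_fun; exact: continuous_sin.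
Qed.

(** Both images have the characteristic function given by [psi] at the same quadratic form. The
    dimensions [n] and [n'] may differ, which allows comparison with the standard pair. *)
Lemma eq_law_generator d (T : measurableType d) (P : probability T R) n
    (X : {RV P >-> 'cV[R]_n}) mu Sigma
    d' (T' : measurableType d') (P' : probability T' R) n'
    (X' : {RV P' >-> 'cV[R]_n'}) mu' Sigma' psi
    m (M : 'M[R]_(m, n)) (N : 'M[R]_(m, n')) :
  has_generator X mu Sigma psi -> has_generator X' mu' Sigma' psi ->
  M *m Sigma *m M^T = N *m Sigma' *m N^T ->
  eq_law P P' (fun w => M *m (X w - mu)) (fun w => N *m (X' w - mu')).
Proof.
move=> gX gX' MN.
have mZ := measurable_affine M mu (measurable_funPT X).
have mZ' := measurable_affine N mu' (measurable_funPT X').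
pose Z : {RV P >-> 'cV[R]_m} := HB.pack (fun w => M *m (X w - mu))
  (isMeasurableFun.Build _ _ _ _ (fun w => M *m (X w - mu)) mZ).
pose Z' : {RV P' >-> 'cV[R]_m} := HB.pack (fun w => N *m (X' w - mu'))
  (isMeasurableFun.Build _ _ _ _ (fun w => N *m (X' w - mu')) mZ').
apply: (@charfun_unique _ _ (distribution P Z) (distribution P' Z')) => x.
have pull (g : R -> R) : continuous g -> (forall t, `|g t| <= 1) ->
  (\int[distribution P Z]_v (g (dotc x v))%:E =
    \int[P]_w (g (dotc x (Z w)))%:E)%E /\
  (\int[distribution P' Z']_v (g (dotc x v))%:E =
    \int[P']_w (g (dotc x (Z' w)))%:E)%E.
  move=> cg g1.
  have mg : measurable_fun [set: 'cV[R]_m] (fun v => (g (dotc x v))%:E).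
    apply/measurable_EFinP; apply: measurableT_comp; last exact: measurable_dotc.
    exact: continuous_measurable_fun.
  split; rewrite integral_distribution//.
  + apply: (@le_integrable _ _ _ _ _ _ _ (cst 1%:E)) => //.
    * exact: measurableT_comp.
    * by move=> w _ /=; rewrite lee_fin normr1.
    * exact: finite_measure_integrable_cst.
  + apply: (@le_integrable _ _ _ _ _ _ _ (cst 1%:E)) => //.
    * exact: measurableT_comp.
    * by move=> w _ /=; rewrite lee_fin normr1.
    * exact: finite_measure_integrable_cst.
have [C S] := charfun_affine M x gX.
have [C' S'] := charfun_affine N x gX'.
rewrite /same_integral; split.
- have [-> ->] := pull cos (@continuous_cos R) (@cos_max R).
  by rewrite [LHS]C [RHS]C' MN.
- have [-> ->] := pull sin (@continuous_sin R) (@sin_max R).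
  by rewrite [LHS]S [RHS]S' MN.
Qed.

End generator.

(** * Second moments and absence of atoms for the coordinates *)

Section spherical.
Context {R : realType} d (T : measurableType d) (P : probability T R) n
  (V : {RV P >-> 'cV[R]_n}).

(** Since [A *m A^T] is the identity, [A] is orthogonal; so the coordinates of [A *m U] are bounded
    by 1, and [Rad], of second moment [n], dominates. *)
Lemma representation_Lfun2 (i : 'I_n) : has_representation V 0 1%:M ->
  rv_coord V i \in Lfun P 2%:E.
Proof.
move=> [d' [T' [P' [Rad [U [A [[R0 R2] [_ AA] _ [U1 _] VU]]]]]]].
apply: Lfun2P; first exact: measurable_fun_coord.
have mVU : measurable_fun [set: T'] (fun w => 0 + Rad w *: (A *m U w)).
  apply: measurable_fun_cV => j.
  rewrite (_ : (fun w => _) =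
      fun w => Rad w * (A *m (U w - 0)) j ord0); last first.
    by apply/funext => w; rewrite add0r subr0 !mxE.
  apply: measurable_funM; first exact: measurable_funPT.
  apply: (measurableT_comp (measurable_coord j)).
  exact: (measurable_affine _ _ (measurable_funPT U)).
have mf : measurable_fun [set: 'cV[R]_n] (fun v : 'cV[R]_n => v i ord0 ^+ 2).
  by apply: measurable_funX; exact: measurable_coord.
have -> := expectation_eq_law (measurable_funPT V) mVU VU mf.
have AU w : (A *m U w) i ord0 ^+ 2 <= 1.
  have : ((A *m U w)^T *m (A *m U w)) ord0 ord0 = 1.
    by rewrite trmx_mul mulmxA -[_ *m A]mulmxA (mulmx1C AA) mulmx1; exact: U1.
  rewrite mxE => <-; rewrite (bigD1 i)//= [_^T _ _]mxE -expr2.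
  rewrite lerDl sumr_ge0// => j _.
  by rewrite [_^T _ _]mxE -expr2 sqr_ge0.
apply: (@le_lt_trans _ _ ('E_P'[fun w => (Rad w ^+ 2)%R])%E); last first.
  by rewrite R2 ltry.
rewrite expectation.unlock ge0_le_integral//.
- by move=> w _; rewrite lee_fin sqr_ge0.
- by apply/measurable_EFinP; exact: (measurableT_comp mf).
- by apply/measurable_EFinP; apply: measurable_funX; exact: measurable_funPT.
- move=> w _; rewrite lee_fin /= add0r mxE exprMn ler_piMr ?sqr_ge0//.
Qed.

(** The hyperplane is the countable union of its parts [S k]. Each part lies in the orthant below
    [y k] but outside the one lowered slightly in direction [i], so its mass is at most an increment
    of the joint distribution function, which tends to 0. *)
Lemma joint_cdf_atomless (i : 'I_n) (c : R) : continuous (joint_cdf V) ->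
  P (rv_coord V i @^-1` [set c]) = 0%E.
Proof.
move=> cV.
pose y (k : nat) : 'cV[R]_n := \col_j (if j == i then c else k%:R).
pose S k :=
  [set w | rv_coord V i w = c /\ forall j, rv_coord V j w <= y k j ord0].
have mle (x : 'cV[R]_n) :
    measurable [set w | forall j, rv_coord V j w <= x j ord0].
  rewrite (_ : [set w | _] = \bigcap_(j in [set: 'I_n])
      (rv_coord V j @^-1` `]-oo, x j ord0])).
    apply: fin_bigcap_measurable => // j _; rewrite -[_ @^-1` _]setTI.
    exact: measurable_fun_coord.
  apply/seteqP; split => w /= H.
    by move=> j _ /=; rewrite in_itv/=; exact: H.
  by move=> j; have := H j I; rewrite /= in_itv.
have mc : measurable (rv_coord V i @^-1` [set c]).
  by rewrite -[_ @^-1` _]setTI; exact: measurable_fun_coord.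
have mS k : measurable (S k).
  by rewrite (_ : S k = rv_coord V i @^-1` [set c] `&`
    [set w | forall j, rv_coord V j w <= y k j ord0])//; exact: measurableI.
have S0 k : P (S k) = 0%E.
  pose z m := y k - m.+1%:R^-1 *: (delta_mx i ord0 : 'cV[R]_n).
  have zy : z m @[m --> \oo] --> y k.
    rewrite -[y in _ --> y]subr0 -(scale0r (delta_mx i ord0 : 'cV[R]_n)).
    apply: cvgB; first exact: cvg_cst.
    by apply: cvgZr_tmp; exact: cvg_harmonic.
  have H : joint_cdf V (y k) - joint_cdf V (z m) @[m --> \oo] --> (0 : R).
    rewrite -[X in _ --> X](subrr (joint_cdf V (y k))).
    by apply: cvgB; [exact: cvg_cst|exact: (cvg_comp _ _ zy (cV (y k)))].
  apply/eqP; rewrite -measure_le0 -(fineK (fin_num_measure P _ (mS k))) lee_fin.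
  apply: (cvgr_to_ge H); apply: nearW => m.
  pose G (x : 'cV[R]_n) := [set w | forall j, rv_coord V j w <= x j ord0].
  rewrite lerBrDr -lee_fin EFinD /joint_cdf !fineK ?fin_num_measure//;
    [|exact: mle..].
  have zik : z m i ord0 < c.
    by rewrite !mxE !eqxx mulr1 ltrBlDr ltrDl invr_gt0.
  have zjk j : z m j ord0 <= y k j ord0.
    by rewrite /z !mxE lerBlDr lerDl mulr_ge0 ?invr_ge0.
  have disj : S k `&` G (z m) = set0.
    rewrite -subset0 => w [[wc _] /(_ i)]; rewrite wc.
    by move=> /(lt_le_trans zik); rewrite ltxx.
  rewrite -(measureU P (mS k) (mle (z m)) disj).
  apply: le_measure; rewrite ?inE; [|exact: mle|].
  - by apply: measurableU => //; exact: mle.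
  - move=> w [[_ wy]|wz] j; first exact: wy.
    exact: le_trans (wz j) (zjk j).
rewrite (_ : _ @^-1` _ = \bigcup_k S k).
  apply: measure_negligible; first exact: bigcupT_measurable.
  by apply: negligible_bigcup => k; exists (S k); split;
    [exact: mS|exact: S0|exact: subset_refl].
apply/seteqP; split => w /=; last by move=> [k _ []].
move=> wc; pose M := \sum_j `|rv_coord V j w|.
exists (Num.truncn M).+1 => //; split => // j; rewrite mxE.
case: eqP => [->|_]; first by rewrite wc.
rewrite (le_trans _ (ltW (truncnS_gt _)))// (le_trans (ler_norm _))//.
by rewrite /M (bigD1 j)//= lerDl sumr_ge0.
Qed.

End spherical.

(** * Bilinear forms and positive definite matrices *)

Section quadratic_form.
Context {R : comPzRingType} {n : nat}.
Implicit Types (S : 'M[R]_n) (u v w : 'rV[R]_n).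

(** For [S] the covariance matrix of a vector, this is the covariance of its linear combinations
    with coefficients [u] and [v]. *)
Definition mxform S u v : R := (u *m S *m v^T) ord0 ord0.

Lemma mxformDl S u v w : mxform S (u + v) w = mxform S u w + mxform S v w.
Proof. by rewrite /mxform !mulmxDl mxE. Qed.

Lemma mxformZl S c u w : mxform S (c *: u) w = c * mxform S u w.
Proof. by rewrite /mxform -!scalemxAl mxE. Qed.

Lemma mxformC S u v : S^T = S -> mxform S u v = mxform S v u.
Proof.
move=> ST; rewrite /mxform -[in LHS](trmxK (u *m S *m v^T)) [LHS]mxE.
by rewrite !trmx_mul trmxK ST mulmxA.
Qed.

Lemma mxform_congr m (M : 'M[R]_(m, n)) S i j :
  (M *m S *m M^T) i j = mxform S (row i M) (row j M).
Proof.
rewrite /mxform -row_mul !mxE; apply: eq_bigr => k _.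
by rewrite tr_row [row i _ _ _]mxE [col j _ _ _]mxE.
Qed.

End quadratic_form.

Section posdef.
Context {R : realType} {n : nat} (Sigma : 'M[R]_n).
Hypothesis pS : posdef Sigma.
Implicit Types (u v : 'rV[R]_n).

Lemma posdef_gt0 u : u != 0 -> 0 < mxform Sigma u u.
Proof.
move=> u0; have := pS.2 u^T; rewrite trmxK; apply.
by apply: contra_neq u0 => /(congr1 trmx); rewrite trmxK trmx0.
Qed.

Lemma posdef_cauchy_schwarz u v : u != 0 ->
  mxform Sigma u v ^+ 2 / mxform Sigma u u <= mxform Sigma v v.
Proof.
move=> u0; have uu := posdef_gt0 u0.
set a := mxform _ u u in uu *; set b := mxform _ u v.
(* The residual of the projection of [v] on [u], orthogonal to [u] for the form [Sigma]. *)
pose w := v + (- (b / a)) *: u.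
have ww : 0 <= mxform Sigma w w.
  by have [->|/posdef_gt0/ltW//] := eqVneq w 0; rewrite /mxform trmx0 mulmx0 mxE.
suff E : mxform Sigma w w = mxform Sigma v v - b ^+ 2 / a by rewrite -subr_ge0 -E.
rewrite mxformDl mxformZl (mxformC _ w pS.1) (mxformC u w pS.1).
rewrite !mxformDl !mxformZl (mxformC v u pS.1) -/a -/b; field.
by rewrite gt_eqF.
Qed.

End posdef.

(** * Variance and covariance identities *)

Section covariance.
Context {R : realType} d (T : measurableType d) (Q : probability T R).

(** Reduces the conditional covariances of [X] to conditional variances of its linear
    combinations. *)
Lemma covariance_polarization (f g : T -> R) :
  f \in Lfun Q 2%:E -> g \in Lfun Q 2%:E ->
  fine (covariance Q f g) =
  (fine 'V_Q[f \+ g] - fine 'V_Q[f] - fine 'V_Q[g]) / 2.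
Proof.
move=> f2 g2.
have Q1 : Q setT \is a fin_num by rewrite probability_setT.
have c : covariance Q f g \is a fin_num.
  apply: covariance_fin_num; [exact: Lfun_subset12..|exact: Lfun2_mul_Lfun1].
rewrite (varianceD f2 g2) !fineD ?fin_numD ?fin_numM ?variance_fin_num// fineM//=.
by field.
Qed.

Lemma variance_linear (p r c : R) (f g : T -> R) :
  f \in Lfun Q 2%:E -> g \in Lfun Q 2%:E -> covariance Q f g = 0%E ->
  fine 'V_Q[fun w => p * f w + r * g w + c] =
    p ^+ 2 * fine 'V_Q[f] + r ^+ 2 * fine 'V_Q[g].
Proof.
move=> f2 g2 fg0.
have Q1 : Q setT \is a fin_num by rewrite probability_setT.
have pf : p \o* f \in Lfun Q 2%:E by apply: Lfun_scale => //; rewrite ler1n.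
have rg : r \o* g \in Lfun Q 2%:E by apply: Lfun_scale => //; rewrite ler1n.
rewrite (_ : (fun w => _) = ((p \o* f) \+ (r \o* g)) \+ cst c); last first.
  by apply/funext => w /=; rewrite (mulrC p) (mulrC r).
rewrite varianceD_cst_r; last exact: (Lfun_addr_closed Q (lee1n 2)).2.
rewrite varianceD// !varianceZ//.
rewrite covarianceZl; last 3 first.
- exact: Lfun_subset12.
- exact: Lfun_subset12.
- exact: Lfun2_mul_Lfun1.
rewrite covarianceZr; last 3 first.
- exact: Lfun_subset12.
- exact: Lfun_subset12.
- exact: Lfun2_mul_Lfun1.
rewrite fg0 !mule0 adde0.
by rewrite fineD ?fin_numM ?variance_fin_num// !fineM ?variance_fin_num.
Qed.

Lemma variance_eq0_ae (f : T -> R) : f \in Lfun Q 2%:E -> 'V_Q[f] = 0%E ->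
  exists c, Q (f @^-1` [set c]) = 1%E.
Proof.
move=> f2; have mf := Lfun2_measurable f2.
rewrite /variance unlock; set c := fine _; rewrite expectation.unlock => V0.
exists c.
pose g w := (((f \- cst c) * (f \- cst c)) w)%:E.
have mg : measurable_fun [set: T] g.
  by apply/measurable_EFinP; apply: measurable_funM; exact: measurable_funB.
have : (\int[Q]_w `|g w| = 0)%E.
  rewrite -[RHS]V0; apply: eq_integral => w _.
  by rewrite gee0_abs// lee_fin -expr2 sqr_ge0.
move/(ae_eq_integral_abs _ measurableT mg) => [N [mN N0 gN]].
have mc : measurable (f @^-1` [set c]) by rewrite -[_ @^-1` _]setTI; exact: mf.
have C0 : Q (~` (f @^-1` [set c])) = 0%E.
  apply/eqP; rewrite -measure_le0 -N0 le_measure ?inE//; first exact: measurableC.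
  move=> w fw; apply: gN => /= /(_ I) [/eqP]; rewrite mulf_eq0 orbb subr_eq0.
  by move/eqP.
by have := probability_setC Q (measurableC mc); rewrite setCK C0 sube0.
Qed.

End covariance.

(** * The standard pair given an event on its first coordinate *)

Section standard_pair.
Context {R : realType} d (T : measurableType d) (P : probability T R)
  (V : {RV P >-> 'cV[R]_2}) (psi : R -> R[i]) (A : set R).
Hypotheses (hV : elliptical V 0 1%:M psi) (mA : measurable A).

Let F (y : R) : R := fine (cdf (rv_coord V 0 : {RV P >-> R}) y).
(** [B] is the preimage of this set under [V], the form that [eq_law_cond] handles. *)
Let E : set 'cV[R]_2 := [set v | A (F (v 0 ord0))].
Let B := cdf_event P (rv_coord V 0) A.
Let Q := cond_prob P B.

Lemma measurable_cdf_coord_event : measurable E.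
Proof.
have mF : measurable_fun [set: 'cV[R]_2] (fun v : 'cV[R]_2 => F (v 0 ord0)).
  apply: (measurableT_comp _ (measurable_coord 0)).
  apply: measurableT_comp => //; exact: cdf_measurable.
by rewrite -[E]setTI; exact: mF.
Qed.

Lemma measurable_cdf_event_coord : measurable B.
Proof.
rewrite -[B]setTI.
exact: (measurable_funPT V measurableT _ measurable_cdf_coord_event).
Qed.

Lemma cond_coord_Lfun2 i : rv_coord V i \in Lfun Q 2%:E.
Proof.
apply: Lfun2_cond; first exact: measurable_cdf_event_coord.
by have [_ _ _ rV] := hV; exact: representation_Lfun2 rV.
Qed.

(** The reflection [D] preserves the law and the event, so the difference and the sum of the
    coordinates have the same conditional variance; these variances differ by four times the
    covariance. *)
Lemma cond_coord_uncorrelated : covariance Q (rv_coord V 0) (rv_coord V 1) = 0%E.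
Proof.
have [gV _ _ _] := hV.
pose D : 'M[R]_2 := diag_mx (\row_j (-1) ^+ j).
have DD : D *m 1%:M *m D^T = 1%:M *m 1%:M *m 1%:M^T.
  rewrite !mulmx1 mul1mx trmx1 tr_diag_mx mulmx_diag.
  apply/matrixP => i j; rewrite !mxE; have [_|//] := eqVneq i j.
  by rewrite -expr2 -exprM mulnC exprM sqrrN !expr1n.
have law := eq_law_generator gV gV DD.
have mZ (M : 'M[R]_2) := measurable_affine M 0 (measurable_funPT V).
have lawQ := eq_law_cond (mZ D) (mZ 1%:M) measurable_cdf_coord_event law.
have DE k w : (D *m (V w - 0)) k ord0 = (-1) ^+ k * rv_coord V k w.
  by rewrite subr0 /D mul_diag_mx !mxE.
have IE k w : (1%:M *m (V w - 0)) k ord0 = rv_coord V k w.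
  by rewrite subr0 mul1mx.
have BD : (fun w => D *m (V w - 0)) @^-1` E = B.
  by apply/funext => w; rewrite /preimage/= /E /= DE expr0 mul1r.
have B1 : (fun w => 1%:M *m (V w - 0)) @^-1` E = B.
  by apply/funext => w; rewrite /preimage/= /E /= IE.
rewrite BD B1 -/Q in lawQ.
have mf : measurable_fun [set: 'cV[R]_2]
    (fun v : 'cV[R]_2 => v 0 ord0 + v 1 ord0).
  by apply: measurable_funD; exact: measurable_coord.
have := variance_eq_law (mZ D) (mZ 1%:M) lawQ mf.
rewrite (_ : _ \o _ = rv_coord V 0 \- rv_coord V 1); last first.
  by apply/funext => w /=; rewrite !DE expr0 expr1 mul1r mulN1r.
rewrite (_ : _ \o _ = rv_coord V 0 \+ rv_coord V 1); last first.
  by apply/funext => w /=; rewrite !IE.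
have L := cond_coord_Lfun2.
have Q1 : Q setT \is a fin_num by rewrite probability_setT.
rewrite varianceB// varianceD//.
have c : covariance Q (rv_coord V 0) (rv_coord V 1) \is a fin_num.
  apply: covariance_fin_num; [exact: Lfun_subset12..|exact: Lfun2_mul_Lfun1].
rewrite -(fineK c) -(fineK (variance_fin_num (L 0))).
rewrite -(fineK (variance_fin_num (L 1))).
by rewrite -!EFinM -!EFinD => -[?]; congr (_%:E); lra.
Qed.

(** Otherwise the first coordinate would be concentrated under [Q] on one point, which is null for
    [P] and hence for [Q], including when [P B] is 0 and [Q] is [P]. *)
Lemma cond_coord_variance_neq0 : fine 'V_Q[rv_coord V 0] != 0.
Proof.
apply/eqP => V0.
have [c] : exists c, Q (rv_coord V 0 @^-1` [set c]) = 1%E.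
  apply: variance_eq0_ae; first exact: cond_coord_Lfun2.
  by rewrite -(fineK (variance_fin_num (cond_coord_Lfun2 0))) V0.
have mc : measurable (rv_coord V 0 @^-1` [set c]).
  by rewrite -[_ @^-1` _]setTI; exact: measurable_fun_coord.
have [_ cV _ _] := hV; have Pc := joint_cdf_atomless 0 c cV.
rewrite /Q (cond_probE P measurable_cdf_event_coord mc) Pc.
case: ifP => _; first by move=> /eqP; rewrite eq_sym onee_eq0.
rewrite (_ : P _ = 0%E) ?mul0e => [/eqP|]; first by rewrite eq_sym onee_eq0.
apply/eqP; rewrite -measure_le0 -Pc le_measure ?inE//.
by apply: measurableI => //; exact: measurable_cdf_event_coord.
Qed.

End standard_pair.

(* The conditional variance of [b X] is [cond_form Sigma a kappa b] times that of
   the first coordinate of the standard pair. *)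
Definition cond_form (R : realType) n (Sigma : 'M[R]_n) (a : 'rV[R]_n) (kappa : R)
    (b : 'rV[R]_n) : R :=
  let q := mxform Sigma a b ^+ 2 / mxform Sigma a a in
  q + (mxform Sigma b b - q) * kappa.

(** * Transfer of linear combinations of [X] to the standard pair *)

Section conditional_variance.
Context {R : realType} (psi : R -> R[i]) (A : set R) (mA : measurable A)
  d' (T' : measurableType d') (P' : probability T' R)
  (V : {RV P' >-> 'cV[R]_2}) (hV : elliptical V 0 1%:M psi)
  (n : nat) d (T : measurableType d) (P : probability T R)
  (X : {RV P >-> 'cV[R]_n}) (mu : 'cV[R]_n) (Sigma : 'M[R]_n)
  (hX : elliptical X mu Sigma psi) (a : 'rV[R]_n) (ha : a != 0).

Let Q := cond_prob P (cdf_event P (lincomb a X) A).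
Let Q' := cond_prob P' (cdf_event P' (rv_coord V 0) A).

(** [p] and [r] are chosen before [f], which is later the square, for integrability, and the
    identity, for the variance. *)
Lemma cond_lincomb_eq_law (b : 'rV[R]_n) : exists p r : R,
  [/\ p ^+ 2 = mxform Sigma a b ^+ 2 / mxform Sigma a a,
      p ^+ 2 + r ^+ 2 = mxform Sigma b b &
      forall f : R -> R, measurable_fun setT f ->
        let h w := f (p * rv_coord V 0 w + r * rv_coord V 1 w +
                      (b *m mu) ord0 ord0) in
        ('E_Q[fun w => f (lincomb b X w)] = 'E_Q'[h])%E /\
        ('V_Q[fun w => f (lincomb b X w)] = 'V_Q'[h])%E].
Proof.
have [gX _ pS _] := hX; have [gV _ _ _] := hV.
have aa : 0 < mxform Sigma a a by exact: posdef_gt0.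
pose s := Num.sqrt (mxform Sigma a a).
have s0 : 0 < s by rewrite sqrtr_gt0.
have s2 : s ^+ 2 = mxform Sigma a a by rewrite sqr_sqrtr// ltW.
pose p := s^-1 * mxform Sigma a b.
have p2 : p ^+ 2 = mxform Sigma a b ^+ 2 / mxform Sigma a a.
  by rewrite /p exprMn -s2 exprVn mulrC.
(* The radicand is nonnegative by the Cauchy-Schwarz inequality. *)
pose r := Num.sqrt (mxform Sigma b b - p ^+ 2).
have r2 : r ^+ 2 = mxform Sigma b b - p ^+ 2.
  by rewrite sqr_sqrtr// subr_ge0 p2 posdef_cauchy_schwarz.
exists p, r; split => //; first by rewrite r2 addrC subrK.
(* The rows of [M] give the standardized [a X] and [b X]; [N] is the Cholesky factor of
   [M *m Sigma *m M^T]. *)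
pose M : 'M[R]_(2, n) := \matrix_(i < 2) (if i == 0 then s^-1 *: a else b).
pose N : 'M[R]_2 := \matrix_(i < 2)
  (if i == 0 then delta_mx 0 0 else p *: delta_mx 0 0 + r *: delta_mx 0 1).
have NE w0 w1 (v : 'cV[R]_2) : v 0 ord0 = w0 -> v 1 ord0 = w1 ->
    (N *m v) 0 ord0 = w0 /\ (N *m v) 1 ord0 = p * w0 + r * w1.
  move=> <- <-; split.
    by rewrite mxE big_ord_recl big_ord1 !mxE/= ?mxE/= mul1r mul0r addr0.
  rewrite mxE big_ord_recl big_ord1 !mxE/= ?mxE/=.
  rewrite !(mulr0, mulr1, addr0, add0r); congr (_ * v _ _ + _ * v _ _);
    exact: val_inj.
have MN : M *m Sigma *m M^T = N *m 1%:M *m N^T.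
  have SC := mxformC _ _ pS.1.
  have M00 : mxform Sigma (s^-1 *: a) (s^-1 *: a) = 1.
    by rewrite mxformZl SC mxformZl -s2; field; exact: lt0r_neq0.
  have M01 : mxform Sigma (s^-1 *: a) b = p by rewrite mxformZl.
  have M10 : mxform Sigma b (s^-1 *: a) = p by rewrite SC.
  have I00 : mxform (1%:M : 'M[R]_2) (delta_mx 0 0) (delta_mx 0 0) = 1.
    by rewrite /mxform mulmx1 trmx_delta mul_delta_mx mxE eqxx.
  have I11 : mxform (1%:M : 'M[R]_2) (delta_mx 0 1) (delta_mx 0 1) = 1.
    by rewrite /mxform mulmx1 trmx_delta mul_delta_mx mxE eqxx.
  have I01 : mxform (1%:M : 'M[R]_2) (delta_mx 0 0) (delta_mx 0 1) = 0.
    rewrite /mxform mulmx1 trmx_delta. by rewrite mul_delta_mx_0// mxE.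
  have IC u v := @mxformC R 2 1%:M u v (trmx1 _ _).
  apply/matrixP => i j; rewrite !mxform_congr !rowK.
  case: (i == 0); case: (j == 0).
  - by rewrite M00 I00.
  - by rewrite M01 IC mxformDl !mxformZl I00 (IC _ (delta_mx 0 0)) I01; ring.
  - by rewrite M10 mxformDl !mxformZl I00 (IC _ (delta_mx 0 0)) I01; ring.
  - rewrite mxformDl !mxformZl !(IC (delta_mx 0 _) (_ + _)) !mxformDl !mxformZl.
    rewrite (IC (delta_mx 0 1)) I00 I11 I01.
    by rewrite -[LHS](subrK (p ^+ 2)) -r2; ring.
pose E : set 'cV[R]_2 :=
  [set v | A (fine (cdf (rv_coord V 0 : {RV P' >-> R}) (v 0 ord0)))].
have law := eq_law_generator gX gV MN.
have mZ := measurable_affine M mu (measurable_funPT X).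
have mZ' := measurable_affine N 0 (measurable_funPT V).
have lawQ := eq_law_cond mZ mZ' (measurable_cdf_coord_event V mA) law.
pose Z w := M *m (X w - mu).
pose Z' w := N *m (V w - 0).
have Z'0 w : Z' w 0 ord0 = rv_coord V 0 w.
  by rewrite /Z' subr0; have [-> _] := NE _ _ (V w) erefl erefl.
have Z'1 w : Z' w 1 ord0 = p * rv_coord V 0 w + r * rv_coord V 1 w.
  by rewrite /Z' subr0; have [_ ->] := NE _ _ (V w) erefl erefl.
have ME i w : Z w i ord0 = (row i M *m (X w - mu)) ord0 ord0.
  by rewrite -row_mul [RHS]mxE.
have sub00 (u v : 'M[R]_1) :
    (u - v) ord0 ord0 = u ord0 ord0 - v ord0 ord0 by rewrite !mxE.
have Z0 w : Z w 0 ord0 = s^-1 * (lincomb a X w - (a *m mu) ord0 ord0).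
  by rewrite ME rowK/= -scalemxAl [LHS]mxE mulmxBr sub00.
have Z1 w : Z w 1 ord0 = lincomb b X w - (b *m mu) ord0 ord0.
  by rewrite ME rowK/= mulmxBr sub00.
(* Standardization is an increasing affine map, so it preserves the distribution function evaluated
   at its own variable; both events thus become preimages of [E]. *)
have cdfE w : cdf (lincomb a X : {RV P >-> R}) (lincomb a X w) =
    cdf (rv_coord V 0 : {RV P' >-> R}) (Z w 0 ord0).
  pose t := Z w 0 ord0.
  have mC : measurable [set v : 'cV[R]_2 | v 0 ord0 <= t].
    rewrite (_ : [set _ | _] = (fun v : 'cV[R]_2 => v 0 ord0) @^-1` `]-oo, t]).
      by rewrite -[_ @^-1` _]setTI; exact: measurable_coord.
    by apply/seteqP; split => v /=; rewrite in_itv.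
  have := law _ mC.
  rewrite /cdf /distribution /pushforward => H.
  transitivity (P (Z @^-1` [set v : 'cV[R]_2 | v 0 ord0 <= t])).
    congr (P _); apply/seteqP; split => w' /=; rewrite in_itv/= Z0 /t Z0;
    by rewrite ler_pM2l ?invr_gt0// lerD2r.
  rewrite [LHS]H; congr (P' _); apply/seteqP; split => w' /=;
    by rewrite in_itv/= Z'0.
have BE : Z @^-1` E = cdf_event P (lincomb a X) A.
  by apply/funext => w; rewrite /cdf_event /preimage /E /= -cdfE.
have BE' : Z' @^-1` E = cdf_event P' (rv_coord V 0) A.
  by apply/funext => w; rewrite /cdf_event /preimage /E /= Z'0.
rewrite -/Z -/Z' -/E BE BE' -/Q -/Q' in lawQ.
move=> f mf /=.
(* [Z] is centered, so [b *m mu] is added back before [f] is applied. *)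
pose g (v : 'cV[R]_2) := f (v 1 ord0 + (b *m mu) ord0 ord0).
have mg : measurable_fun setT g.
  apply: measurableT_comp => //; apply: measurable_funD => //.
  exact: measurable_coord.
have := expectation_eq_law mZ mZ' lawQ mg.
have := variance_eq_law mZ mZ' lawQ mg.
have -> : g \o (fun w => M *m (X w - mu)) = fun w => f (lincomb b X w).
  by apply/funext => w; rewrite /g /= -/(Z w) Z1 subrK.
have -> : g \o (fun w => N *m (V w - 0)) = fun w => f (p * rv_coord V 0 w +
    r * rv_coord V 1 w + (b *m mu) ord0 ord0).
  by apply/funext => w; rewrite /g /= -/(Z' w) Z'1.
by [].
Qed.

End conditional_variance.

(** * Conditional correlations of [X] *)

Section conditional_correlation.
Context {R : realType} (psi : R -> R[i]) (A : set R) (mA : measurable A)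
  d' (T' : measurableType d') (P' : probability T' R)
  (V : {RV P' >-> 'cV[R]_2}) (hV : elliptical V 0 1%:M psi)
  (n : nat) d (T : measurableType d) (P : probability T R)
  (X : {RV P >-> 'cV[R]_n}) (mu : 'cV[R]_n) (Sigma : 'M[R]_n)
  (hX : elliptical X mu Sigma psi) (a : 'rV[R]_n) (ha : a != 0).

Let Q := cond_prob P (cdf_event P (lincomb a X) A).
Let Q' := cond_prob P' (cdf_event P' (rv_coord V 0) A).

Lemma cond_lincomb_Lfun2 (b : 'rV[R]_n) : lincomb b X \in Lfun Q 2%:E.
Proof.
have [p [r [_ _ law]]] := cond_lincomb_eq_law mA hV hX ha b.
apply: Lfun2P; first exact: measurable_fun_lincomb.
rewrite (law (fun x => x ^+ 2) _).1; last exact: exprn_measurable.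
apply: Lfun2_expectation.
have addL := (Lfun_addr_closed Q' (lee1n 2)).2.
have L i := cond_coord_Lfun2 hV mA i.
have sL (c : R) i : (fun w => c * rv_coord V i w) \in Lfun Q' 2%:E.
  rewrite (_ : (fun w => _) = c \o* rv_coord V i).
    by apply: Lfun_scale; rewrite ?ler1n//; exact: L.
  by apply/funext => w /=; rewrite mulrC.
exact: addL (addL _ _ (sL p 0) (sL r 1)) (Lfun_cst Q' _ _).
Qed.

Lemma cond_variance_lincomb (b : 'rV[R]_n) :
  fine 'V_Q[lincomb b X] =
  fine 'V_Q'[rv_coord V 0] * cond_form Sigma a (var_ratio V A) b.
Proof.
have [p [r [p2 r2 law]]] := cond_lincomb_eq_law mA hV hX ha b.
rewrite (law idfun _).2; last exact: measurable_id.
rewrite variance_linear; [|exact: cond_coord_Lfun2 hV mA _..|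
  exact: cond_coord_uncorrelated hV mA].
(* Allows the conditional variance of the second coordinate to be written as the ratio times that of
   the first. *)
have v0 := cond_coord_variance_neq0 hV mA.
rewrite /cond_form -p2 -r2 addrAC subrr add0r /var_ratio; field.
exact: v0.
Qed.

(** The right-hand side involves [A] and the two laws only through [Sigma] and [var_ratio V A], so
    equal ratios yield equal matrices. *)
Lemma cond_cor_elliptical :
  let v := cond_form Sigma a (var_ratio V A) in
  let e (i : 'I_n) : 'rV[R]_n := delta_mx 0 i in
  cond_cor P (cdf_event P (lincomb a X) A) X =
  \matrix_(i, j) ((v (e i + e j) - v (e i) - v (e j)) / 2 /
    Num.sqrt (v (e i) * v (e j))).
Proof.
move=> v e.
have coordE i : rv_coord X i = lincomb (e i) X.
  by apply/funext => w; rewrite /lincomb -rowE mxE.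
have v0 : 0 < fine 'V_Q'[rv_coord V 0].
  by rewrite lt0r (cond_coord_variance_neq0 hV mA) fine_ge0// variance_ge0.
apply/matrixP => i j; rewrite !mxE -/Q !coordE.
rewrite covariance_polarization; [|exact: cond_lincomb_Lfun2..].
rewrite (_ : lincomb (e i) X \+ lincomb (e j) X =
    lincomb (e i + e j) X); last first.
  by apply/funext => w; rewrite /lincomb mulmxDl mxE.
rewrite !cond_variance_lincomb -!/(v _).
set c := fine _ in v0 *.
rewrite mulrACA sqrtrM ?mulr_ge0 ?(ltW v0)// -expr2 sqrtr_sqr gtr0_norm//.
have cV1 : c * c^-1 = 1 by rewrite divff// gt_eqF.
(* Only the positive factor [c] is cancelled; the inverse of the remaining root is kept as an
   arbitrary number. *)
rewrite invfM -[RHS]mulr1 -[X in _ = _ * X]cV1.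
by move: (Num.sqrt _)^-1 => x; move: c^-1 => c'; ring.
Qed.

End conditional_correlation.

Theorem proposition6p2 (R : realType) (k : nat) (hk : (2 <= k)%N)
  (psi : R -> R[i]) (hpsi : char_generator psi)
  (Bstar : 'I_k -> set R) (hBstar : borel_partition_01 Bstar)
  (hK : forall i j : 'I_k, Kprime psi (Bstar i) = Kprime psi (Bstar j))
  (n : nat) (d : measure_display) (T : measurableType d)
  (P : probability T R) (X : {RV P >-> 'cV[R]_n})
  (mu : 'cV[R]_n) (Sigma : 'M[R]_n) (hX : elliptical X mu Sigma psi)
  (a : 'rV[R]_n) (ha : a != 0) :
  forall i j : 'I_k,
    cond_cor P (cdf_event P (lincomb a X) (Bstar i)) X =
    cond_cor P (cdf_event P (lincomb a X) (Bstar j)) X.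
Proof.
move=> i j; have [mB _ _] := hBstar.
(* The value picked by [xget] is the ratio of some standard pair, possibly a
   different one for each set, and [cond_cor_elliptical] holds for all of them. *)
have K A : exists (d' : measure_display) (T' : measurableType d')
    (P' : probability T' R) (V : {RV P' >-> 'cV[R]_2}),
    elliptical V 0 1%:M psi /\ Kprime psi A = var_ratio V A.
  apply: (xgetPex 0 (P := [set kappa | exists (d : measure_display)
    (T : measurableType d) (P : probability T R) (V : {RV P >-> 'cV[R]_2}),
    elliptical V 0 1%:M psi /\ kappa = var_ratio V A])).
  have [d' [T' [P' [V hV]]]] := hpsi.
  by exists (var_ratio V A), d', T', P', V.
have [di [Ti [Pi [Vi [hVi Ki]]]]] := K (Bstar i).
have [dj [Tj [Pj [Vj [hVj Kj]]]]] := K (Bstar j).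
rewrite (cond_cor_elliptical (mB i).1 hVi hX ha).
by rewrite (cond_cor_elliptical (mB j).1 hVj hX ha) -Ki -Kj (hK i j).
Qed.
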